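(* Let $r\ge 2$. Let $P_{n,\ell}^{(r)}$ be the total number of points at level $\ell$ over all paths in $\mathcal{A}_{n,0}^{(r)}$. Then $P_{0,0}^{(r)}=1$ and for all integers $n\ge 1$ and $0\le \ell\le n$, $$P_{n,\ell}^{(r)}=\sum_{j=0}^{n-\ell}\binom{n-\ell}{j}\left\{\frac{2\ell}{(2n-j)(r-1)}\binom{2n-j}{n-\ell}+\frac{2\ell+2}{2n-j+2}\binom{2n-j+2}{n-\ell}\right\}(r-1)^{n-j}.$$ Moreover, for all $n,\ell\ge0$, $P_{n,\ell}^{(r)}+\frac{1}{r-1}\delta_{n,0}$ is the $(n,\ell)$-entry of the Riordan array $\left(S_r(x)^2+\frac{1}{r-1},\ x(r-1)S_r(x)^2\right)$, i.e. $$P_{n,\ell}^{(r)}+\frac{\delta_{n,0}}{r-1}=[x^n]\left(S_r(x)^2+\frac{1}{r-1}\right)\left(x(r-1)S_r(x)^2\right)^{\ell},$$ where $\delta_{n,0}=1$ if $n=0$ and $0$ otherwise (and $P_{n,\ell}^{(r)}=0$ for $\ell>n$).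
   Context: A Dyck path of length $2n$ is a lattice path from $(0,0)$ to $(2n,0)$ weakly above the $x$-axis with up-steps $\mathbf{u}=(1,1)$ and down-steps $\mathbf{d}=(1,-1)$; an $r$-colored Dyck path has each $\mathbf{d}$-step colored by one of $r$ colors. $\mathcal{A}_{n,0}^{(r)}$ is the set of $r$-colored Dyck paths of length $2n$ in which no two consecutive $\mathbf{d}$-steps have the same color. A point of a path is at level $\ell$ if its ordinate is $\ell$ (all $2n+1$ lattice points of the path are counted). $S_r(x)=\frac{1-x-\sqrt{(1-x)^2-4(r-1)x}}{2(r-1)x}$ is the unique power series with $S_r(x)=1+xS_r(x)+(r-1)xS_r(x)^2$. A Riordan array $(d(x),h(x))$ is the matrix whose $(n,k)$-entry is $[x^n]d(x)h(x)^k$.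
   Formalization: In the Riordan identity the term δ_{n,0}/(r-1) is replaced by δ_{n,0}δ_{ℓ,0}/(r-1), because for n=0 and ℓ≥1 the printed identity is false: its left side is 1/(r-1) and its right side is 0. *)

(* Defs.v *)
From HB Require Import structures.
From mathcomp Require Import all_boot all_order all_algebra.
From mathcomp Require Import boolp.
From mathcomp Require Import ring.

Set Implicit Arguments.
Unset Strict Implicit.
Unset Printing Implicit Defensive.

Import Order.TTheory GRing.Theory Num.Theory.
Local Open Scope ring_scope.

(** * Colored Dyck paths *)

(* [None] is the up-step u; [Some c] is a down-step d with color c. *)
Definition step (r : nat) := option 'I_r.

Definition step_val (r : nat) (s : step r) : int :=
  if s is Some _ then - 1 else 1.

(* The lattice points of a path w are (i, ordinate w i) for 0 <= i <= size w. *)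
Definition ordinate (r : nat) (w : seq (step r)) (i : nat) : int :=
  \sum_(s <- take i w) step_val s.

Definition is_dyck (r : nat) (w : seq (step r)) : bool :=
  all (fun i => 0 <= ordinate w i) (iota 0 (size w).+1)
  && (ordinate w (size w) == 0).

Definition not_same_down (r : nat) (s t : step r) : bool :=
  ~~ (isSome s && (s == t)).

Definition no_same_consecutive_downs (r : nat) (w : seq (step r)) : bool :=
  sorted (@not_same_down r) w.

Definition colored_dyck (r n : nat) : {set (2 * n).-tuple (step r)} :=
  [set w : (2 * n).-tuple (step r) |
     is_dyck w && no_same_consecutive_downs w].

Definition points_at_level (r n l : nat) : nat :=
  (\sum_(w in colored_dyck r n)
     #|[set i : 'I_(2 * n).+1 | ordinate w i == l%:Z]|)%N.

(** * Formal power series *)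

Record fps (R : Type) := Fps { coefs : nat -> R }.

Notation "[x^ n ] f" := (coefs f n)
  (at level 10, n at level 8, f at level 9, format "[x^ n ]  f").

Section FpsRing.
Variable R : comNzRingType.
Implicit Types f g h : fps R.

HB.instance Definition _ := gen_eqMixin (fps R).
HB.instance Definition _ := gen_choiceMixin (fps R).

Definition fps_zero : fps R := Fps (fun=> 0).
Definition fps_one : fps R := Fps (fun n => (n == 0)%:R).
Definition fps_opp f : fps R := Fps (fun n => - [x^n] f).
Definition fps_add f g : fps R := Fps (fun n => [x^n] f + [x^n] g).
Definition fps_mul f g : fps R :=
  Fps (fun n => \sum_(i < n.+1) [x^i] f * [x^(n - i)] g).

Lemma fpsP f g : (forall n, [x^n] f = [x^n] g) -> f = g.
Proof. by case: f g => f [g] /= fg; congr Fps; apply/funext. Qed.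

Fact fps_addA : associative fps_add.
Proof. by move=> f g h; apply: fpsP => n /=; rewrite addrA. Qed.
Fact fps_addC : commutative fps_add.
Proof. by move=> f g; apply: fpsP => n /=; rewrite addrC. Qed.
Fact fps_add0 : left_id fps_zero fps_add.
Proof. by move=> f; apply: fpsP => n /=; rewrite add0r. Qed.
Fact fps_addN : left_inverse fps_zero fps_opp fps_add.
Proof. by move=> f; apply: fpsP => n /=; rewrite addNr. Qed.

HB.instance Definition _ :=
  GRing.isZmodule.Build (fps R) fps_addA fps_addC fps_add0 fps_addN.

(* Coefficients of a product only depend on truncations, so the ring axioms
   are inherited from those of polynomials. *)
Definition fps_trunc f m : {poly R} := \poly_(i < m) [x^i] f.

Lemma coef_fps_trunc_mul f g m n : (n < m)%N ->
  [x^n] (fps_mul f g) = (fps_trunc f m * fps_trunc g m)`_n.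
Proof.
move=> nm; rewrite coefM; apply: eq_bigr => i _.
have im : (i < m)%N by apply: leq_trans nm; rewrite ltn_ord.
by rewrite !coef_poly im (leq_ltn_trans (leq_subr _ _) nm).
Qed.

Fact fps_mulC : commutative fps_mul.
Proof.
by move=> f g; apply: fpsP => n; rewrite !(@coef_fps_trunc_mul _ _ n.+1) // mulrC.
Qed.

Fact fps_mulA : associative fps_mul.
Proof.
move=> f g h; apply: fpsP => n.
pose T k := fps_trunc k n.+1.
have -> : [x^n] (fps_mul f (fps_mul g h)) = (T f * (T g * T h))`_n.
  rewrite coefM; apply: eq_bigr => i _.
  rewrite coef_poly ltn_ord (@coef_fps_trunc_mul _ _ n.+1) //.
  by rewrite ltnS leq_subr.
rewrite mulrA coefM; apply: eq_bigr => i _.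
by rewrite (@coef_fps_trunc_mul _ _ n.+1) // coef_poly ltnS leq_subr.
Qed.

Fact fps_mul1 : left_id fps_one fps_mul.
Proof.
move=> f; apply: fpsP => n /=; rewrite big_ord_recl /= mul1r subn0.
by rewrite big1 ?addr0 // => i _; rewrite mul0r.
Qed.

Fact fps_mulDl : left_distributive fps_mul fps_add.
Proof.
move=> f g h; apply: fpsP => n /=; rewrite -big_split /=.
by apply: eq_bigr => i _; rewrite mulrDl.
Qed.

Fact fps_one_neq0 : fps_one != 0 :> fps R.
Proof.
apply/eqP => /(congr1 (fun f => [x^0] f)) /= /eqP.
by rewrite oner_eq0.
Qed.

HB.instance Definition _ :=
  GRing.Zmodule_isComNzRing.Build (fps R)
    fps_mulA fps_mulC fps_mul1 fps_mulDl fps_one_neq0.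

Definition fpsC (c : R) : fps R := Fps (fun n => if n == 0 then c else 0).
Definition fpsX : fps R := Fps (fun n => (n == 1)%:R).

Lemma coef_fpsXM f n : [x^n] (fpsX * f) = if n is m.+1 then [x^m] f else 0.
Proof.
case: n => [|n]; first by rewrite [LHS]big_ord1 /= mul0r.
rewrite [LHS]big_ord_recl [X in X * _]/= mul0r add0r.
rewrite big_ord_recl /= mul1r subn1 /= big1 ?addr0 // => i _.
by rewrite mul0r.
Qed.

Lemma coef_fpsCM c f n : [x^n] (fpsC c * f) = c * [x^n] f.
Proof.
rewrite [LHS]big_ord_recl /= subn0 big1 ?addr0 // => i _.
by rewrite mul0r.
Qed.

(* The (n, k)-entry of the Riordan array (d, h). *)
Definition riordan (d h : fps R) (n k : nat) : R := [x^n] (d * h ^+ k).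

End FpsRing.

Arguments fpsX {R}.

(** * The series S_r *)

(* [sr_prefix r n] lists s_0, ..., s_n, where
   s_0 = 1 and s_(m+1) = s_m + (r - 1) * \sum_(i <= m) s_i * s_(m-i). *)
Fixpoint sr_prefix (r n : nat) : seq rat :=
  if n is m.+1 then
    let p := sr_prefix r m in
    rcons p (p`_m + (r%:R - 1) * \sum_(i < m.+1) p`_i * p`_(m - i))
  else [:: 1].

Definition Sr (r : nat) : fps rat := Fps (fun n => (sr_prefix r n)`_n).

Lemma size_sr_prefix r n : size (sr_prefix r n) = n.+1.
Proof. by elim: n => //= n IHn; rewrite size_rcons IHn. Qed.

Lemma nth_sr_prefix r n i : (i <= n)%N -> (sr_prefix r n)`_i = [x^i] (Sr r).
Proof.
elim: n => [|n IHn]; first by rewrite leqn0 => /eqP ->.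
rewrite leq_eqVlt => /predU1P[-> //|]; rewrite ltnS => le_in.
by rewrite /= nth_rcons size_sr_prefix ltnS le_in IHn.
Qed.

Definition sr_equation (r : nat) (S : fps rat) : Prop :=
  S = 1 + fpsX * S + fpsC (r%:R - 1) * fpsX * S ^+ 2.

Lemma sr_equationP r S : sr_equation r S <->
  [x^0] S = 1 /\
  forall n, [x^n.+1] S =
    [x^n] S + (r%:R - 1) * \sum_(i < n.+1) [x^i] S * [x^(n - i)] S.
Proof.
have coefE n : [x^n] (1 + fpsX * S + fpsC (r%:R - 1) * fpsX * S ^+ 2) =
    (n == 0)%:R + [x^n] (fpsX * S)
      + (r%:R - 1) * [x^n] (fpsX * (S * S)).
  by rewrite -mulrA -coef_fpsCM expr2.
split=> [SE|[S0 SS]].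
  split=> [|n]; first by rewrite SE coefE !coef_fpsXM mulr0 !addr0.
  by rewrite {1}SE coefE !coef_fpsXM add0r.
apply: fpsP => -[|n]; rewrite coefE !coef_fpsXM ?S0 ?mulr0 ?addr0 //.
by rewrite SS add0r.
Qed.

Lemma Sr_equation r : sr_equation r (Sr r).
Proof.
apply/sr_equationP; split=> // n.
rewrite /= nth_rcons size_sr_prefix ltnn eqxx; congr (_ + _ * _).
apply: eq_bigr => i _; rewrite !nth_sr_prefix ?leq_subr //.
by rewrite -ltnS.
Qed.

Lemma Sr_unique r S : sr_equation r S -> S = Sr r.
Proof.
move=> /sr_equationP[S0 SS].
have /sr_equationP[T0 TT] := Sr_equation r.
apply: fpsP => n; elim/ltn_ind: n => -[_|n IHn]; first by rewrite S0 T0.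
rewrite SS TT IHn //; congr (_ + _ * _); apply: eq_bigr => i _.
by rewrite !IHn // ltnS leq_subr.
Qed.

(* S_r = (1 - x - sqrt D) / (2 (r-1) x), where D = (1 - x)^2 - 4 (r-1) x and
   sqrt D is the square root of D with constant term 1. *)
Lemma Sr_closed_form r : exists2 D : fps rat,
  D ^+ 2 = (1 - fpsX) ^+ 2 - 4%:R * fpsC (r%:R - 1) * fpsX /\ [x^0] D = 1
  & 2%:R * fpsC (r%:R - 1) * fpsX * Sr r = 1 - fpsX - D.
Proof.
set c := fpsC (r%:R - 1); set S := Sr r.
have SE : S = 1 + fpsX * S + c * fpsX * S ^+ 2 by exact: Sr_equation.
exists (1 - fpsX - 2%:R * c * fpsX * S); last by ring.
split.
  have -> : (1 - fpsX - 2%:R * c * fpsX * S) ^+ 2 =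
      (1 - fpsX) ^+ 2 - 4%:R * c * fpsX * S
      + 4%:R * c * fpsX * (fpsX * S + c * fpsX * S ^+ 2) by ring.
  have -> : fpsX * S + c * fpsX * S ^+ 2 = S - 1 by rewrite [in RHS]SE; ring.
  by ring.
have -> : 2%:R * c * fpsX * S = fpsX * (2%:R * c * S) by ring.
change (1 - 0 - [x^0] (fpsX * (2%:R * c * S)) = 1 :> rat).
by rewrite coef_fpsXM !subr0.
Qed.

(* Main.v *)
(* Cut a path at a point of level l. Marking half-steps by t (so x = t^2) and
   writing T = S_r(t^2), c = r - 1, the prefixes ending at height l have
   generating function (tT)^l if the last step is u and (tT)^l (T - 1) if it is
   d; the suffixes have generating function (ctT)^l T after a d, and
   (ctT)^l T + t (ctT)^(l-1) T after a u (l > 0), since only the color of a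
   first step d is constrained by the prefix. These series are characterized by
   linear recurrences read off a finite-memory automaton scanning the path.
   Pairing them gives the Riordan array. Its entries are coefficients of powers
   of S_r, which the recurrence S^(k+1) = S^k + x S^(k+1) + c x S^(k+2)
   determines. *)
Require Import Defs.
From mathcomp Require Import all_boot all_order all_algebra.
From mathcomp Require Import ring zify.

Set Implicit Arguments.
Unset Strict Implicit.
Unset Printing Implicit Defensive.

Import Order.TTheory GRing.Theory Num.Theory.
Local Open Scope ring_scope.

(** * Coefficient rules and the substitution of t^2 for x *)

Section FpsExtra.
Variable R : comNzRingType.
Implicit Types f g : fps R.

Lemma coef_fpsD f g n : [x^n] (f + g) = [x^n] f + [x^n] g.
Proof. by []. Qed.

Lemma coef_fps_sum (I : finType) (F : I -> fps R) n :
  [x^n] (\sum_i F i) = \sum_i [x^n] (F i).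
Proof.
apply: (big_morph (fun f : fps R => [x^n] f)) => // f g; exact: coef_fpsD.
Qed.

Lemma fpsC_natr n : fpsC n%:R = n%:R :> fps R.
Proof.
elim: n => [|n IHn]; first by apply: fpsP => -[].
rewrite -[RHS]natr1 -IHn; apply: fpsP => -[|m] /=; last by rewrite addr0.
by rewrite -natr1.
Qed.

Lemma coef_fpsXnM f m n : [x^(m + n)] (fpsX ^+ m * f) = [x^n] f.
Proof. by elim: m => [|m IHm]; rewrite ?mul1r // exprS -mulrA coef_fpsXM. Qed.

Lemma coef_fpsXnM_lt f m n : (n < m)%N -> [x^n] (fpsX ^+ m * f) = 0.
Proof.
elim: m n => [|m IHm] [|n] //; rewrite exprS -mulrA coef_fpsXM // ltnS.
exact: IHm.
Qed.

Lemma fpsC_expr (c : R) n : fpsC c ^+ n = fpsC (c ^+ n).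
Proof.
elim: n => [|n IHn].
  by apply: fpsP => n; rewrite [LHS]/= [RHS]/=; case: eqP.
rewrite exprS IHn; apply: fpsP => m; rewrite coef_fpsCM /= exprS.
by case: eqP; rewrite ?mulr0.
Qed.

(** The series f(t^2): it passes from x to half-steps t, a path of length 2n having weight x^n =
    t^(2n). *)
Definition fps_dilate f : fps R :=
  Fps (fun n => if odd n then 0 else [x^(n./2)] f).

Lemma coef_fps_dilate2 f n : [x^(2 * n)] (fps_dilate f) = [x^n] f.
Proof. by rewrite /= mul2n odd_double doubleK. Qed.

Lemma fps_dilateD f g : fps_dilate (f + g) = fps_dilate f + fps_dilate g.
Proof. by apply: fpsP => n /=; case: ifP; rewrite ?addr0. Qed.

Lemma fps_dilateC c : fps_dilate (fpsC c) = fpsC c.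
Proof. by apply: fpsP => -[|[|n]] //=; case: ifP. Qed.

Lemma fps_dilate1 : fps_dilate 1 = 1.
Proof. by apply: fpsP => -[|[|n]] //=; case: ifP. Qed.

Lemma fps_dilateX : fps_dilate fpsX = fpsX ^+ 2.
Proof.
apply: fpsP => n; rewrite expr2 coef_fpsXM; case: n => [|[|[|n]]] //=.
by case: ifP; case: n.
Qed.

Lemma sum_even (h : nat -> R) m : (forall i, odd i -> h i = 0) ->
  \sum_(i < m.*2.+1) h i = \sum_(i < m.+1) h i.*2.
Proof.
move=> h0; elim: m => [|m IHm]; first by rewrite !big_ord1.
by rewrite [RHS]big_ord_recr doubleS 2![in LHS]big_ord_recr /= IHm h0 ?addr0 /= ?odd_double.
Qed.

Lemma fps_dilateM f g : fps_dilate (f * g) = fps_dilate f * fps_dilate g.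
Proof.
apply: fpsP => n; rewrite [RHS]/= [LHS]/=; case: ifP => [n_odd|].
  rewrite big1 // => i _; case: ifP => i_odd; rewrite ?mul0r //.
  by rewrite oddB ?leq_ord // n_odd i_odd mulr0.
move=> n_even; rewrite -[n in RHS]odd_double_half n_even add0n.
pose h i := (if odd i then 0 else [x^(i./2)] f) *
  (if odd (n./2.*2 - i) then 0 else [x^((n./2.*2 - i)./2)] g).
rewrite -[RHS]/(\sum_(i < n./2.*2.+1) h i) sum_even.
  apply: eq_bigr => i _; rewrite /h odd_double doubleK -doubleB.
  by rewrite odd_double doubleK.
by move=> i oi; rewrite /h oi mul0r.
Qed.

Lemma fps_dilate_expr f n : fps_dilate (f ^+ n) = fps_dilate f ^+ n.
Proof.
by elim: n => [|n IHn]; rewrite ?fps_dilate1 // !exprS fps_dilateM IHn.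
Qed.

End FpsExtra.

(** * Coefficients of the powers of S_r *)

Section PowersOfSr.
Variable r : nat.
Let c : rat := r%:R - 1.
Let S := Sr r.

Lemma coef_Sr_expr_rec N k : [x^N.+1] (S ^+ k.+1) =
  [x^N.+1] (S ^+ k) + [x^N] (S ^+ k.+1) + c * [x^N] (S ^+ k.+2).
Proof.
have E : S ^+ k.+1 = S ^+ k + fpsX * S ^+ k.+1 + fpsC c * (fpsX * S ^+ k.+2).
  by rewrite exprSr {2}[S]Sr_equation -/S -/c !exprSr; ring.
by rewrite {1}E 2!coef_fpsD coef_fpsCM !coef_fpsXM.
Qed.

Lemma coef0_Sr_expr k : [x^0] (S ^+ k) = 1.
Proof. by elim: k => // k IHk; rewrite exprS [LHS]big_ord1 IHk mulr1. Qed.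

(* The coefficient of c^M in [x^(j + M)] S^k; the truncated predecessor is
   harmless because it only matters for k = 0, where the factor k vanishes. *)
Definition ballot (j M k : nat) : rat :=
  (k * (j + 2 * M + k).-1`!)%:R / (j`! * M`! * (M + k)`!)%:R.

Lemma natr_fact_neq0 n : n`!%:R != 0 :> rat.
Proof. by rewrite pnatr_eq0 -lt0n fact_gt0. Qed.

(** Over a common denominator this is (k+1)(j+2M+k) = k(M+k+1) + (k+1)j + (k+2)M. The hypothesis
    makes j+2M+k positive, so that [.-1] is a true predecessor. *)
Lemma ballot_rec j M k : (0 < j + M)%N ->
  ballot j M k.+1 = ballot j M k
    + (if j is i.+1 then ballot i M k.+1 else 0)
    + (if M is L.+1 then ballot j L k.+2 else 0).
Proof.
move=> jM_gt0; rewrite /ballot.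
set W := (j + 2 * M + k).-1`!.
have WE : (j + 2 * M + k.+1).-1`! = ((j + 2 * M + k) * W)%N.
  rewrite /W addnS /=; have : (0 < j + 2 * M + k)%N by lia.
  by case: (j + 2 * M + k)%N.
rewrite WE addnS !factS.
have -> : (if j is i.+1 then (k.+1 * (i + 2 * M + k.+1).-1`!)%:R /
     (i`! * M`! * ((M + k).+1 * (M + k)`!))%:R else 0) =
     (k.+1 * j * W)%:R / (j`! * M`! * ((M + k).+1 * (M + k)`!))%:R :> rat.
  case: j @W WE {jM_gt0} => [|i] W _; first by rewrite muln0 mul0n mul0r.
  have -> : (i + 2 * M + k.+1).-1 = (i.+1 + 2 * M + k).-1 by lia.
  rewrite -/W factS !natrM; field.
   by rewrite -?natrD ?nat1r !natr_fact_neq0 !pnatr_eq0.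
have -> : (if M is L.+1 then (k.+2 * (j + 2 * L + k.+2).-1`!)%:R /
     (j`! * L`! * (L + k.+2)`!)%:R else 0) =
     (k.+2 * M * W)%:R / (j`! * M`! * ((M + k).+1 * (M + k)`!))%:R :> rat.
  case: M @W WE {jM_gt0} => [|L] W _; first by rewrite muln0 mul0n mul0r.
  have -> : (j + 2 * L + k.+2).-1 = (j + 2 * L.+1 + k).-1 by lia.
  have -> : (L + k.+2)`! = ((L.+1 + k).+1 * (L.+1 + k)`!)%N.
    by rewrite -factS; congr (_`!); lia.
  rewrite -/W factS.
  move: (natr_fact_neq0 (L.+1 + k)); move: (L.+1 + k)`! (L.+1 + k)%N => F m nF.
  rewrite !natrM; field.
  by rewrite nF -?natrD ?nat1r !natr_fact_neq0 !pnatr_eq0.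
have nMk1 : (M + k).+1%:R != 0 :> rat by rewrite pnatr_eq0.
move: (natr_fact_neq0 j) (natr_fact_neq0 M) (natr_fact_neq0 (M + k)) nMk1 => nj nM nMk.
rewrite !natrM; have -> : k.+2%:R = k%:R + 2 :> rat by rewrite -addn2 natrD.
clear WE; move: j`! M`! (M + k)`! W nj nM nMk => a b d w na nb nd.
rewrite !natrD -!natr1 !natrD => nMk1.
by field; rewrite na nb nd nMk1.
Qed.

(** Induction on N, then on k, as the recurrence lowers N or keeps N and lowers k. At N = k = 0 the
    coefficient is 1 but [ballot] is 0. *)
Lemma coef_Sr_expr N k : (0 < N + k)%N ->
  [x^N] (S ^+ k) = \sum_(j < N.+1) ballot j (N - j) k * c ^+ (N - j).
Proof.
have b0 j M : ballot j M 0 = 0 by rewrite /ballot mul0n mul0r.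
elim: N k => [|N IHN] k.
  case: k => // k _; rewrite coef0_Sr_expr big_ord1 /ballot expr0 mulr1.
  by rewrite muln0 !add0n -factS fact0 !mul1n divff // natr_fact_neq0.
move=> _; elim: k => [|k IHk].
  by rewrite expr0 big1 // => j _; rewrite b0 mul0r.
rewrite coef_Sr_expr_rec IHk !IHN ?addnS //.
under [in RHS]eq_bigr => j _.
  rewrite ballot_rec ?subnKC ?leq_ord // 2!mulrDl; over.
(* The last two sums lose their terms at j = 0 and at M = 0 respectively; what remains matches the
   powers k+1 and k+2 in degree N. *)
rewrite !big_split /=; congr (_ + _ + _).
  rewrite [RHS]big_ord_recl mul0r add0r; apply: eq_bigr => j _.
  by rewrite /= subSS.
rewrite [RHS]big_ord_recr /= subnn mul0r addr0 mulr_sumr.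
by apply: eq_bigr => j _; rewrite subSn ?leq_ord // exprS mulrCA mulrA.
Qed.

(** Clearing factorials gives the shape of the final formula, where N = n - l and k is 2l or 2l +
    2. *)
Lemma ballotE N k j : (j <= N)%N -> (0 < N + k)%N ->
  ballot j (N - j) k =
    'C(N, j)%:R * (k%:R / (2 * N + k - j)%:R * 'C(2 * N + k - j, N)%:R).
Proof.
move=> jN Nk; rewrite /ballot.
have -> : (j + 2 * (N - j) + k = 2 * N + k - j)%N by lia.
have H1 := bin_fact jN.
have H2 : (N <= 2 * N + k - j)%N by lia.
have := bin_fact H2.
have -> : (2 * N + k - j - N = N - j + k)%N by lia.
have : (0 < 2 * N + k - j)%N by lia.
case: (2 * N + k - j)%N => // m _ H3 /=.
move/(congr1 (fun n => n%:R : rat)): H1; move/(congr1 (fun n => n%:R : rat)): H3.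
rewrite factS !natrM.
have := natr_fact_neq0 N; have := natr_fact_neq0 j; have := natr_fact_neq0 (N - j).
have := natr_fact_neq0 (N - j + k).
have : m.+1%:R != 0 :> rat by rewrite pnatr_eq0.
move: (N`!%:R) (j`!%:R) ((N - j)`!%:R) (m.+1%:R) ((N - j + k)`!%:R) (m`!%:R).
move=> A B C D E F hD hE hC hB hA H2' H1'.
have -> : F = 'C(m.+1, N)%:R * (A * E) / D by rewrite H2'; field.
by rewrite -H1'; field; rewrite hB hC hD hE.
Qed.

End PowersOfSr.

(** * Sums over words, split at the first step, the last step or a cut *)

Section TupleSums.
Variables (T : finType) (V : nmodType).
Implicit Types phi : seq T -> V.

Lemma sum_tuple0 phi : \sum_(w : 0.-tuple T) phi w = phi [::].
Proof.
rewrite (big_pred1 [tuple]) // => w; rewrite [RHS]eq_sym.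
by apply/esym/eqP; rewrite [w]tuple0.
Qed.

Lemma sum_tupleS n phi :
  \sum_(w : n.+1.-tuple T) phi w = \sum_(x : T) \sum_(w : n.-tuple T) phi (x :: w).
Proof.
rewrite pair_bigA (reindex (fun p : T * n.-tuple T => [tuple of p.1 :: p.2])) //=.
exists (fun w : n.+1.-tuple T => (thead w, [tuple of behead w])) => [[x w] _|w _].
  by congr (_, _) => //; apply: val_inj.
by rewrite [RHS]tuple_eta.
Qed.

Lemma sum_tuple_cat m n phi :
  \sum_(w : (m + n).-tuple T) phi w =
  \sum_(u : m.-tuple T) \sum_(v : n.-tuple T) phi (u ++ v).
Proof.
elim: m phi => [|m IHm] phi; first by rewrite [RHS](sum_tuple0 (fun u => \sum_v phi (u ++ tval v))).
rewrite sum_tupleS [RHS](sum_tupleS _ (fun u => \sum_v phi (u ++ tval v))).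
by apply: eq_bigr => x _; apply: (IHm (fun w => phi (x :: w))).
Qed.

Lemma sum_tuple_split m n phi : (m <= n)%N ->
  \sum_(w : n.-tuple T) phi w =
  \sum_(u : m.-tuple T) \sum_(v : (n - m).-tuple T) phi (u ++ v).
Proof. by move=> mn; rewrite -sum_tuple_cat subnKC. Qed.

Lemma sum_tuple_rcons n phi :
  \sum_(w : n.+1.-tuple T) phi w =
  \sum_(w : n.-tuple T) \sum_(x : T) phi (rcons w x).
Proof.
rewrite -[n.+1]addn1 sum_tuple_cat; apply: eq_bigr => w _.
rewrite (sum_tupleS _ (fun v => phi (w ++ v))); apply: eq_bigr => x _.
by rewrite (sum_tuple0 (fun v => phi (w ++ x :: v))) cats1.
Qed.

Lemma sum_option (F : option T -> V) :
  \sum_(s : option T) F s = F None + \sum_(x : T) F (Some x).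
Proof.
rewrite (bigD1 None) //=; congr (_ + _).
rewrite (reindex_omap Some id) => [|[]] //=.
by apply: eq_bigl => x; rewrite eqxx.
Qed.

End TupleSums.

(** * The automaton that scans a path *)

Section Automaton.
Variable r : nat.

(* [Some (h, s)]: current height and last step; [None]: the word has left the
   set of prefixes of admissible paths. *)
Definition state := option (nat * step r).

Definition advance (st : state) (s : step r) : state :=
  if st is Some (h, p) then
    if not_same_down p s then
      match s, h with
      | None, _ => Some (h.+1, s)
      | Some _, h'.+1 => Some (h', s)
      | Some _, 0 => None
      end
    else None
  else None.

Definition run (st : state) (w : seq (step r)) : state := foldl advance st w.

(* [not_same_down None s] always holds, so "last step u" also serves as the
   state of the empty word. *)
Definition start : state := Some (0%N, None).

Definition at_height (h : nat) (st : state) : bool :=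
  if st is Some (h', _) then h' == h else false.

Definition last_is_down (st : state) : bool :=
  if st is Some (_, p) then isSome p else false.

Lemma run_cat st u v : run st (u ++ v) = run (run st u) v.
Proof. exact: foldl_cat. Qed.

Lemma run_None w : run None w = None.
Proof. by elim: w. Qed.

Lemma ordinate_rcons (w : seq (step r)) s i : (i <= size w)%N ->
  ordinate (rcons w s) i = ordinate w i.
Proof.
move=> iw; rewrite /ordinate -cats1 take_cat; case: ltnP => // wi.
have -> : i = size w by apply/eqP; rewrite eqn_leq iw.
by rewrite subnn take0 cats0 take_size.
Qed.

(** Appending a step adds one ordinate and one adjacent pair to test, which is what [advance]
    checks. *)
Lemma run_start w : run start w =
  if all (fun i => 0 <= ordinate w i) (iota 0 (size w).+1)
     && path (@not_same_down r) None w
  then Some (`|ordinate w (size w)|%N, last None w) else None.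
Proof.
elim/last_ind: w => [|w s IHw]; first by rewrite /= /ordinate big_nil.
rewrite /run foldl_rcons -/(run _ w) IHw size_rcons last_rcons rcons_path.
rewrite -[(size w).+2]addn1 iotaD all_cat add0n [all _ (iota _ 1)]/= andbT.
rewrite [in RHS](@eq_in_all _ _ (fun i => 0 <= ordinate w i)); last first.
  by move=> i; rewrite mem_iota add0n ltnS => /andP[_ iw]; rewrite ordinate_rcons.
have -> : ordinate (rcons w s) (size w).+1 = ordinate w (size w) + step_val s.
  rewrite {1}/ordinate take_oversize ?size_rcons // -cats1 big_cat big_seq1.
  by rewrite /ordinate take_size.
case: (boolP (all _ _)) => // ord_ge0.
have : 0 <= ordinate w (size w).
  by move/allP: ord_ge0; apply; rewrite mem_iota add0n /=.
case: (ordinate w (size w)) => // h _.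
case: (path _ _ _); rewrite ?andbF //= andbC.
case: (not_same_down _ _) => //=; case: s => [c|] /=; last first.
  by rewrite addn1.
by case: h => [|h] //; rewrite intS addrC addKr.
Qed.

Lemma is_dyck_run (w : seq (step r)) :
  is_dyck w && no_same_consecutive_downs w = at_height 0 (run start w).
Proof.
have sortedE : no_same_consecutive_downs w = path (@not_same_down r) None w.
  by case: w.
rewrite run_start sortedE /is_dyck andbAC.
by case: ifP => //= _; rewrite absz_eq0.
Qed.

(** [None] is absorbing, so each prefix of an accepted word survives and its state records the true
    ordinate. *)
Lemma ordinate_run (w : seq (step r)) i l :
  at_height 0 (run start w) -> (i <= size w)%N ->
  (ordinate w i == l%:Z) = at_height l (run start (take i w)).
Proof.
rewrite -[w in run _ w](cat_take_drop i) run_cat => + iw.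
have : run start (take i w) = run start (take i w) by [].
rewrite {2}run_start.
have sz : size (take i w) = i by rewrite size_takel.
case: ifP => [/andP[ord_ge0 _] ->|_ ->]; last by rewrite run_None.
rewrite /= sz => _.
have ordE : ordinate (take i w) i = ordinate w i by rewrite /ordinate take_takel.
have : 0 <= ordinate w i.
  by rewrite -ordE; move/allP: ord_ge0; apply; rewrite mem_iota sz add0n ltnSn.
by rewrite ordE; case: (ordinate w i).
Qed.

Lemma points_at_level_run n l :
  (points_at_level r n l)%:R = \sum_(i < (2 * n).+1)
    \sum_(w : (2 * n).-tuple (step r))
      (at_height 0 (run start w) && at_height l (run start (take i w)))%:R :> rat.
Proof.
rewrite exchange_big /points_at_level natr_sum big_mkcond.
apply: eq_bigr => w _; rewrite inE is_dyck_run.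
case: (boolP (at_height 0 _)) => [w0|_]; last by rewrite big1.
rewrite -sum1_card natr_sum big_mkcond; apply: eq_bigr => i _.
rewrite inE (ordinate_run _ w0) ?size_tuple ?leq_ord //=.
by case: (at_height l _).
Qed.

(** * Generating functions of prefixes and suffixes *)

Let T : fps rat := fps_dilate (Sr r).
Let c : fps rat := fpsC (r%:R - 1).
Let t : fps rat := fpsX.

Lemma dilated_Sr_equation : T = 1 + t ^+ 2 * T + c * t ^+ 2 * T ^+ 2.
Proof.
rewrite {1}/T {1}[Sr r]Sr_equation !fps_dilateD !fps_dilateM.
by rewrite fps_dilateX fps_dilateC fps_dilate1.
Qed.

Lemma fpsC_r : fpsC r%:R = 1 + c.
Proof. by apply: fpsP => -[|n] /=; rewrite ?addr0 // addrC subrK. Qed.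

(* First-passage decomposition: once a d has been read, each further excursion
   T ends in a d (or is empty), so the next d has r - 1 colors; [suffix_up]
   adds the extra color available when the suffix starts with d after a u. *)
Definition suffix_down h : fps rat := (c * t * T) ^+ h * T.
Definition suffix_up h : fps rat :=
  suffix_down h + (if h is h'.+1 then t * suffix_down h' else 0).

(* Last-passage decomposition; the last step is d exactly when the last
   excursion is nonempty. *)
Definition prefix_up h : fps rat := (t * T) ^+ h.
Definition prefix_down h : fps rat := (t * T) ^+ h * (T - 1).

(** First-step analysis after a d: stop at height 0, go up, or go down in one of the r - 1 other
    colors. *)
Lemma suffix_down_rec h : suffix_down h = (h == 0%N)%:R
  + t * suffix_up h.+1 + (if h is h'.+1 then c * (t * suffix_down h') else 0).
Proof.
rewrite /suffix_up /suffix_down; case: h => [|h] /=.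
  by rewrite addr0 expr1 expr0 !mul1r {1}dilated_Sr_equation; ring.
by rewrite !exprS {1}dilated_Sr_equation; ring.
Qed.

Lemma suffix_up_rec h : suffix_up h = (h == 0%N)%:R + t * suffix_up h.+1
  + (if h is h'.+1 then (1 + c) * (t * suffix_down h') else 0).
Proof.
by rewrite {1}/suffix_up suffix_down_rec; case: h => [|h] /=; ring.
Qed.

Lemma prefix_up_rec h : prefix_up h = (h == 0%N)%:R
  + (if h is h'.+1 then t * (prefix_up h' + prefix_down h') else 0).
Proof.
rewrite /prefix_up /prefix_down; case: h => [|h] /=; first by rewrite expr0 addr0.
by rewrite exprS; ring.
Qed.

(** Last-step analysis: the final d has r = 1 + c colors after a u, but only c after a d. *)
Lemma prefix_down_rec h :
  prefix_down h = t * ((1 + c) * prefix_up h.+1 + c * prefix_down h.+1).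
Proof.
by rewrite /prefix_up /prefix_down exprS {1}[T in T - 1]dilated_Sr_equation; ring.
Qed.

(** For l > 0 both sides share (tT)^(l+1) (ctT)^(l-1), leaving c T^2 + 1 = c (T^2 + 1/c). For l = 0
    the products sum to T^2 only, so 1/c has to be added. *)
Lemma prefix_suffix_product l : r%:R - 1 != 0 :> rat ->
  prefix_up l * suffix_up l + prefix_down l * suffix_down l
    + (if l is 0 then fpsC (r%:R - 1)^-1 else 0) =
  fps_dilate ((Sr r ^+ 2 + fpsC (r%:R - 1)^-1)
              * (fpsX * fpsC (r%:R - 1) * Sr r ^+ 2) ^+ l).
Proof.
move=> c_neq0; set c' := fpsC (r%:R - 1)^-1.
have cc' : c * c' = 1.
  by apply: fpsP => n; rewrite coef_fpsCM /=; case: eqP; rewrite ?mulfV ?mulr0.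
rewrite fps_dilateM fps_dilate_expr !fps_dilateM fps_dilateD fps_dilateC.
rewrite fps_dilate_expr fps_dilateX fps_dilateC -/c -/c' -/T -/t.
rewrite /prefix_up /prefix_down /suffix_up /suffix_down.
case: l => [|l] /=; first by rewrite !expr0; ring.
have -> : (T ^+ 2 + c') * (t ^+ 2 * c * T ^+ 2) ^+ l.+1 =
  (t * T) ^+ l.+1 * (c * t * T) ^+ l * (t * T) * (c * T ^+ 2 + c * c').
  have -> : t ^+ 2 * c * T ^+ 2 = (t * T) * (c * t * T) by ring.
  by rewrite exprMn [in LHS](exprS (c * t * T)); ring.
by rewrite cc' !exprS; ring.
Qed.

(** * Counting words by the states they reach *)

Definition suffix_series (st : state) : fps rat :=
  match st with
  | None => 0
  | Some (h, None) => suffix_up h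
  | Some (h, Some _) => suffix_down h
  end.

Lemma coef_fps_delta (b : bool) n : [x^n] (b%:R : fps rat) = (b && (n == 0%N))%:R.
Proof. by case: b => //=. Qed.

Lemma suffix_series_rec st : suffix_series st =
  (at_height 0 st)%:R + t * \sum_(s : step r) suffix_series (advance st s).
Proof.
case: st => [[h p]|]; last by rewrite big1 ?mulr0 ?addr0.
rewrite sum_option; case: p => [a|] /=.
  rewrite suffix_down_rec [in RHS]mulrDr [RHS]addrA; congr (_ + _).
  under eq_bigr => b _ do rewrite /not_same_down /= -[Some a == Some b]/(a == b) if_neg.
  case: h => [|h]; first by rewrite big1 ?mulr0 // => b _; case: ifP.
  rewrite (bigD1 a) //= eqxx add0r.
  under eq_bigr => b ba do rewrite eq_sym (negbTE ba).
  rewrite sumr_const cardC1 card_ord.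
  (* The color [a] shows that r > 0, so the natural-number predecessor is the true r - 1. *)
  have -> : c = r.-1%:R.
    by rewrite -fpsC_natr /c -subn1 natrB // (leq_ltn_trans _ (ltn_ord a)).
  by rewrite mulrnAr mulr_natl.
rewrite suffix_up_rec [in RHS]mulrDr [RHS]addrA; congr (_ + _).
case: h => [|h]; first by rewrite big1 ?mulr0.
by rewrite sumr_const card_ord -fpsC_r fpsC_natr mulrnAr mulr_natl.
Qed.

(** Peeling off the first step reproduces [suffix_series_rec], whose factor t lowers the degree by
    one. *)
Lemma count_suffixes m st :
  \sum_(v : m.-tuple (step r)) (at_height 0 (run st v))%:R =
  [x^m] (suffix_series st).
Proof.
elim: m st => [|m IHm] st; rewrite suffix_series_rec coef_fpsD coef_fpsXM.
  by rewrite (sum_tuple0 (fun v => (at_height 0 (run st v))%:R)) coef_fps_delta andbT addr0.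
rewrite coef_fps_delta andbF add0r.
rewrite (sum_tupleS _ (fun v => (at_height 0 (run st v))%:R)) /=.
rewrite coef_fps_sum; apply: eq_bigr => s _; exact: IHm.
Qed.

(** The color of a last d is forgotten: whatever it is, r - 1 colors remain for a following d. *)
Definition at_state (h : nat) (b : bool) (st : state) : bool :=
  at_height h st && (last_is_down st == b).

Lemma sum_advance_up h st : \sum_(s : step r) (at_state h false (advance st s))%:R =
  (if h is h'.+1 then (at_state h' false st)%:R + (at_state h' true st)%:R
   else 0) :> rat.
Proof.
case: st => [[h0 p]|]; last by rewrite big1; case: h.
rewrite sum_option big1 => [|x _] /=; last first.
  by case: ifP => //; case: h0 => // h0; rewrite /at_state /= andbF.
rewrite addr0; have -> : not_same_down p None by case: p.
rewrite /at_state /=; case: h => [|h] //; rewrite eqSS andbT.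
by case: (h0 == h); case: p; rewrite //= ?addr0 ?add0r.
Qed.

Lemma sum_advance_down h st : \sum_(s : step r) (at_state h true (advance st s))%:R =
  r%:R * (at_state h.+1 false st)%:R
    + (r%:R - 1) * (at_state h.+1 true st)%:R :> rat.
Proof.
case: st => [[h0 p]|]; last by rewrite big1 // !mulr0 addr0.
have advanceE x : at_state h true (advance (Some (h0, p)) (Some x)) =
    not_same_down p (Some x) && (h0 == h.+1).
  by rewrite /=; case: ifP => //; case: h0 => //= h0; rewrite /at_state /= andbT.
rewrite sum_option; under eq_bigr => x _ do rewrite advanceE.
rewrite /at_state /= andbC; case: p {advanceE} => [a|] /=.
  rewrite add0r andbF andbT mulr0 add0r (bigD1 a) //= /not_same_down eqxx add0r.
  under eq_bigr => x xa do rewrite -[Some a == Some x]/(a == x) eq_sym xa /=.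
  rewrite sumr_const cardC1 card_ord -[LHS]mulr_natl -subn1 natrB //.
  exact: leq_ltn_trans (ltn_ord a).
by rewrite add0r andbT andbF mulr0 addr0 sumr_const card_ord mulr_natl.
Qed.

Lemma count_prefixes i h (b : bool) :
  \sum_(u : i.-tuple (step r)) (at_state h b (run start u))%:R =
  [x^i] (if b then prefix_down h else prefix_up h).
Proof.
elim: i h b => [|i IHi] h b.
  rewrite (sum_tuple0 (fun u => (at_state h b (run start u))%:R)).
  rewrite prefix_up_rec prefix_down_rec; case: b; rewrite ?coef_fpsD ?coef_fpsXM.
    by rewrite /at_state /= andbF.
  rewrite coef_fps_delta /at_state /= eq_sym !andbT.
  by case: h => [|h]; rewrite ?coef_fpsXM addr0.
rewrite (sum_tuple_rcons _ (fun u => (at_state h b (run start u))%:R)).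
under eq_bigr => u _ do under eq_bigr => s _ do rewrite /run foldl_rcons -/(run _ _).
rewrite prefix_up_rec prefix_down_rec; case: b.
  under eq_bigr => u _ do rewrite sum_advance_down.
  rewrite big_split -!mulr_sumr !IHi coef_fpsXM coef_fpsD /c.
  by rewrite -fpsC_r !coef_fpsCM.
under eq_bigr => u _ do rewrite sum_advance_up.
rewrite coef_fpsD coef_fps_delta andbF add0r.
case: h => [|h]; first by rewrite big1.
by rewrite big_split !IHi coef_fpsXM coef_fpsD.
Qed.

(** The index of the Cauchy product is the position of the cut. Suffix counts depend only on the
    height and the type of the last prefix step, so each type contributes one product. *)
Lemma points_at_level_product n l : (points_at_level r n l)%:R =
  [x^(2 * n)] (prefix_up l * suffix_up l + prefix_down l * suffix_down l).
Proof.
rewrite points_at_level_run coef_fpsD -[RHS]big_split.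
apply: eq_bigr => i _.
rewrite (sum_tuple_split (fun w : seq (step r) =>
  (at_height 0 (run start w) && at_height l (run start (take i w)))%:R)
  (leq_ord i)).
rewrite -(count_prefixes i l false) -(count_prefixes i l true) !mulr_suml.
rewrite -big_split; apply: eq_bigr => u _ /=.
under eq_bigr => v _ do
  rewrite run_cat take_size_cat ?size_tuple // -mulnb natrM.
rewrite -mulr_suml count_suffixes mulrC.
case: (run start u) => [[h p]|]; last by rewrite !mul0r addr0.
rewrite /at_state /=; case: eqP => [->|_]; last by rewrite !mul0r addr0.
by case: p => [a|] /=; rewrite !mul0r !mul1r ?addr0 ?add0r.
Qed.

End Automaton.

(** * The Riordan array and the explicit formula *)

Lemma points_at_level_riordan r n l : r%:R - 1 != 0 :> rat ->
  (points_at_level r n l)%:R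
    + (r%:R - 1)^-1 * ((n == 0%N) && (l == 0%N))%:R =
  riordan (Sr r ^+ 2 + fpsC (r%:R - 1)^-1)
          (fpsX * fpsC (r%:R - 1) * Sr r ^+ 2) n l.
Proof.
move=> c_neq0; rewrite points_at_level_product /riordan.
rewrite -[RHS]coef_fps_dilate2 -prefix_suffix_product //.
rewrite [RHS]coef_fpsD; congr (_ + _).
case: l => [|l]; rewrite ?andbF ?mulr0 // andbT /=.
by case: n => [|n]; rewrite ?mulr1 ?mulr0.
Qed.

Theorem theorem3p1 (r : nat) (r_ge2 : (2 <= r)%N) :
  [/\ points_at_level r 0 0 = 1%N,
      (forall n l : nat, (1 <= n)%N -> (l <= n)%N ->
        (points_at_level r n l)%:R =
          \sum_(0 <= j < (n - l).+1)
            'C(n - l, j)%:R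
            * ((2 * l)%:R / ((2 * n - j)%:R * (r%:R - 1))
                 * 'C(2 * n - j, n - l)%:R
               + (2 * l + 2)%:R / (2 * n - j + 2)%:R
                 * 'C(2 * n - j + 2, n - l)%:R)
            * (r%:R - 1) ^+ (n - j) :> rat),
      (forall n l : nat, (n < l)%N -> points_at_level r n l = 0%N)
    & (forall n l : nat,
        (points_at_level r n l)%:R
          + (r%:R - 1)^-1 * ((n == 0%N) && (l == 0%N))%:R =
        riordan (Sr r ^+ 2 + fpsC (r%:R - 1)^-1)
                (fpsX * fpsC (r%:R - 1) * Sr r ^+ 2) n l)].
Proof.
have c_neq0 : r%:R - 1 != 0 :> rat.
  by rewrite subr_eq0 pnatr_eq1 gtn_eqF.
have riordanE n l := points_at_level_riordan n l c_neq0.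
have hE l : (fpsX * fpsC (r%:R - 1) * Sr r ^+ 2) ^+ l =
    fpsX ^+ l * (fpsC ((r%:R - 1) ^+ l) * Sr r ^+ (2 * l)) :> fps rat.
  by rewrite 2!exprMn fpsC_expr -exprM mulrA.
split=> [|n l n_gt0 ln|n l nl|//].
- apply/eqP; rewrite -(eqr_nat rat); apply/eqP.
  (* The Riordan entry at n = l = 0 is 1 + 1/(r - 1), so the correction is added to both sides. *)
  apply: (addIr ((r%:R - 1)^-1 * 1)); rewrite riordanE /riordan mulr1 expr0 mulr1.
  by rewrite coef_fpsD coef0_Sr_expr.
- have := riordanE n l; rewrite -[n == _]negbK -lt0n n_gt0 mulr0 addr0 => ->.
  (* The factor x^l moves the coefficient from degree n to degree n - l. *)
  rewrite /riordan hE mulrCA -[X in [x^X] _](subnKC ln) coef_fpsXnM.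
  set N := (n - l)%N.
  (* The powers 2l + 2 and 2l of S_r yield the two summands of the formula. *)
  have -> : (Sr r ^+ 2 + fpsC (r%:R - 1)^-1) *
      (fpsC ((r%:R - 1) ^+ l) * Sr r ^+ (2 * l)) =
      fpsC ((r%:R - 1) ^+ l) * (Sr r ^+ (2 * l + 2)
        + fpsC (r%:R - 1)^-1 * Sr r ^+ (2 * l)) by rewrite exprD; ring.
  rewrite coef_fpsCM coef_fpsD coef_fpsCM !coef_Sr_expr; try lia.
  rewrite big_mkord mulr_sumr -big_split mulr_sumr; apply: eq_bigr => j _ /=.
  have jN : (j <= N)%N by rewrite -ltnS.
  rewrite !ballotE //; try lia.
  have -> : (2 * N + (2 * l + 2) - j = 2 * n - j + 2)%N by lia.
  have -> : (2 * N + 2 * l - j = 2 * n - j)%N by lia.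
  have -> : (n - j = l + (N - j))%N by lia.
  rewrite exprD; move: ((r%:R - 1) ^+ l) ((r%:R - 1) ^+ (N - j)) => cl cN.
  rewrite invfM; ring.
- apply/eqP; rewrite -(eqr_nat rat); apply/eqP.
  have := riordanE n l; rewrite /riordan hE mulrCA coef_fpsXnM_lt //.
  by rewrite [l == 0%N]gtn_eqF ?(leq_trans _ nl) // andbF mulr0 addr0.
Qed.
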